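(* Let $\gamma$ be a simple closed smooth curve in $\mathbb{D}^*=\{z\in\mathbb{C}:0<|z|<1\}$ bounding a domain $V\subset\mathbb{D}=\{z\in\mathbb{C}:|z|<1\}$ which contains $0$. Let $$ds_{\mathrm{out}}^2=\lambda_{\mathrm{out}}^2(x,y)\,(dx^2+dy^2)$$ be a conformal Riemannian metric on $\mathbb{D}\setminus V$, where $\lambda_{\mathrm{out}}$ is a smooth positive function. Suppose that the maximum of $\lambda_{\mathrm{out}}$ on $\gamma$ is attained at a point $z_{\max}\in\gamma$ at which the normal derivative satisfies $\frac{\partial\lambda_{\mathrm{out}}}{\partial\vec{n}}(z_{\max})<0$. Then $ds_{\mathrm{out}}^2$ cannot be extended to a conformal metric of negative curvature in $V$; that is, there is no smooth positive function $\lambda$ on $\mathbb{D}$ which coincides with $\lambda_{\mathrm{out}}$ on $\mathbb{D}\setminus V$ and for which the metric $\lambda^2(x,y)(dx^2+dy^2)$ has negative curvature in $V$.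
   Context: Here $\vec{n}$ denotes the normal vector to $\gamma$ pointing out of $V$. Conformal means conformal to the Euclidean metric $dx^2+dy^2$ on $\mathbb{D}$. The function $\lambda_{\mathrm{out}}$ is smooth up to and including $\gamma$. *)

(* Defs.v *)
From HB Require Import structures.
From mathcomp Require Import all_boot all_order all_algebra.
From mathcomp Require Import all_classical all_reals all_analysis.

Set Implicit Arguments.
Unset Strict Implicit.
Unset Printing Implicit Defensive.

Import Order.TTheory GRing.Theory Num.Theory.
Import numFieldNormedType.Exports.

Local Open Scope classical_set_scope.
Local Open Scope ring_scope.

Section Plane.
Context {R : realType}.

(* C = R^2 is the space of row vectors (x, y).  The library norm on it is the
   max norm, so everything Euclidean goes through [dotp]. *)
Notation plane := 'rV[R]_2.

Definition dotp (u v : plane) : R := \sum_(i < 2) u 0 i * v 0 i.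

Definition unit_disc : set plane := [set z | dotp z z < 1].

Definition punctured_disc : set plane := [set z | 0 < dotp z z < 1].

Definition boundary (A : set plane) : set plane := closure A `\` interior A.

Definition partial (i : 'I_2) (f : plane -> R) : plane -> R :=
  fun z => 'D_(delta_mx 0 i) f z.

Definition iter_partial (s : seq 'I_2) (f : plane -> R) : plane -> R :=
  foldr partial f s.

(* Meant for open [U]: all iterated partial derivatives exist and are
   continuous on [U]. *)
Definition smooth_open (U : set plane) (f : plane -> R) : Prop :=
  forall (s : seq 'I_2) (z : plane), U z ->
    {for z, continuous (iter_partial s f)} /\
    (forall i, derivable (iter_partial s f) z (delta_mx 0 i)).

(* Smoothness on an arbitrary set [A], up to and including the points of [A]
   that are not interior: near each point of [A], [f] agrees on [A] with a
   smooth function defined on an open set. *)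
Definition smooth_on (A : set plane) (f : plane -> R) : Prop :=
  forall z, A z -> exists (U : set plane) (g : plane -> R),
    [/\ open U, U z, smooth_open U g & {in A `&` U, f =1 g}].

(* A 1-periodic regular parametrization of a smooth Jordan curve. *)
Definition simple_closed_smooth_curve (c : R -> plane) : Prop :=
  [/\ forall k t, derivable (derive1n k c) t 1,
      forall t, derive1 c t != 0,
      forall t, c (t + 1) = c t &
      {in `[0, 1[ &, injective c}].

(* A bounded domain with boundary [range c] is the inside of the Jordan curve
   [c]; boundedness is a consequence of [V `<=` unit_disc] where it is used. *)
Definition bounds_domain (c : R -> plane) (V : set plane) : Prop :=
  [/\ open V, connected V & boundary V = range c].

(* [n] is the unit vector orthogonal to the curve at [c t] that points from
   [V] to its complement. *)
Definition outward_normal (V : set plane) (c : R -> plane) (t : R)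
    (n : plane) : Prop :=
  [/\ dotp n n = 1,
      dotp n (derive1 c t) = 0 &
      \forall s \near 0^'+, ~ V (c t + s *: n) /\ V (c t - s *: n)].

(* One-sided, since [f] is only meaningful on the side [n] points to. *)
Definition normal_derivative (f : plane -> R) (n p : plane) : R :=
  lim ((fun s : R => s^-1 * (f (p + s *: n) - f p)) @ 0^'+).

Section Curvature.
Variable g : plane -> 'M[R]_2.

(* Gamma^k_{ij} *)
Definition christoffel (k i j : 'I_2) (z : plane) : R :=
  2^-1 * \sum_(l < 2) invmx (g z) k l *
    (partial i (fun w => g w j l) z + partial j (fun w => g w i l) z
     - partial l (fun w => g w i j) z).

(* The [l]-th component of Riem(e_i, e_j) e_k, where
   Riem(X, Y) Z = nabla_X nabla_Y Z - nabla_Y nabla_X Z - nabla_[X,Y] Z. *)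
Definition riemann (l k i j : 'I_2) (z : plane) : R :=
  partial i (christoffel l j k) z - partial j (christoffel l i k) z
  + \sum_(m < 2) (christoffel l i m z * christoffel m j k z
                  - christoffel l j m z * christoffel m i k z).

(* <Riem(e_0, e_1) e_1, e_0> / (|e_0|^2 |e_1|^2 - <e_0, e_1>^2) *)
Definition gaussian_curvature (z : plane) : R :=
  (\sum_(l < 2) g z l 0 * riemann l 1 0 1 z) / \det (g z).

End Curvature.

(* lambda^2 (dx^2 + dy^2) *)
Definition conformal_metric (lambda : plane -> R) : plane -> 'M[R]_2 :=
  fun z => (lambda z ^+ 2)%:M.

End Plane.

(* Main.v *)
Require Import Defs.
From mathcomp Require Import all_boot all_order all_algebra.
From mathcomp Require Import all_classical all_reals all_analysis.
From mathcomp Require Import ring.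

Import Order.TTheory GRing.Theory Num.Theory.
Import numFieldNormedType.Exports.

Local Open Scope classical_set_scope.
Local Open Scope ring_scope.

(** The curvature of f^2 (dx^2 + dy^2) is - Delta (log f) / f^2
    ([gaussian_curvature_conformal]), so negative curvature makes log f strictly
    subharmonic, which rules out an interior maximum of f.  Concretely, at an
    interior maximum both partial derivatives of grad (log f) = grad f / f along
    their own axes are <= 0 ([partial_dlog_at_max]), and the curvature would be
    >= 0 ([curvature_ge0_at_max]).

    Suppose an extension lambda exists.  It is continuous on the compact closure
    of V, so it has a maximum there, and by the above that maximum lies on the
    boundary curve ([negative_curvature_max_boundary]).  On the curve lambda is
    lambda_out, so the point p = z_max is a maximum of lambda over the whole
    closure of V.  Since lambda is C^1 at p, it has a two-sided derivative along
    the outward normal n ([is_derive_combination]).  Computed from outside, it is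
    the normal derivative of lambda_out, which is negative; then lambda would
    exceed lambda(p) at points p - s n with s > 0 small.  These points lie in V,
    which contradicts the maximality of p. *)

(** * Directional derivatives of C^1 functions *)

Lemma is_derive_line (R : realType) (V : normedModType R) (f : V -> R)
    (p v : V) (t : R) :
  derivable f (t *: v + p) v ->
  is_derive t 1 (fun s : R => f (s *: v + p)) ('D_v f (t *: v + p)).
Proof.
move=> df.
have E : (fun h : R => h^-1 *:
      (((fun s : R => f (s *: v + p)) \o shift t) (h *: 1) - f (t *: v + p))) =
    (fun h : R => h^-1 *:
      ((f \o shift (t *: v + p)) (h *: v) - f (t *: v + p))).
  by apply/funext => h /=; rewrite [h *: 1]mulr1 scalerDl addrA.
by apply: DeriveDef; rewrite /derivable /derive E.
Qed.

(** The intermediate point is t h with 0 < t < 1, which covers both signs of h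
    at once and keeps the point strictly between the two ends. *)
Lemma MVT_line (R : realType) (V : normedModType R) (f : V -> R)
    (p v : V) (h : R) :
  (forall t : R, t \in `[0, 1] -> derivable f ((t * h) *: v + p) v) ->
  exists2 t : R, t \in `]0, 1[ &
    f (h *: v + p) - f p = h * 'D_v f ((t * h) *: v + p).
Proof.
move=> df; pose phi (t : R) := f ((t * h) *: v + p).
have dphi (t : R) : t \in `[0, 1] ->
    is_derive t 1 phi (h * 'D_v f ((t * h) *: v + p)).
  move=> /df /is_derive_line dl.
  have dh : is_derive t 1 ( *%R^~ h) h.
    have -> : *%R^~ h = h *: @id R by apply/funext => s; rewrite mulrC.
    by apply: is_derive_eq; rewrite [LHS]mulr1.
  rewrite [h * _]mulrC.
  exact: (@is_derive1_comp _ _ ( *%R^~ h) t _ _ dl dh).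
have phic : {within `[0, 1], continuous phi}.
  apply: continuous_in_subspaceT => t; rewrite inE => /dphi[+ _].
  by move=> /derivable1_diffP /differentiable_continuous.
have lt01 : (0 : R) < 1 := ltr01.
have dphi' (t : R) : t \in `]0, 1[ ->
    is_derive t 1 phi (h * 'D_v f ((t * h) *: v + p)).
  by move=> /subset_itv_oo_cc; exact: dphi.
have [t t01] := MVT lt01 dphi' phic.
rewrite /phi mul1r mul0r scale0r add0r subr0 mulr1 => E.
by exists t.
Qed.

(** For C^1 functions, being differentiable along two directions gives
    differentiability along their span: an increment along a u + b w is split
    into one step along u and one along w, and the mean value theorem applied to
    each step gives derivatives at points tending to p. *)
Lemma is_derive_combination (R : realType) (V : normedModType R) (f : V -> R)
    (p u w : V) (a b : R) :
  (\forall z \near p, derivable f z u) ->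
  (\forall z \near p, derivable f z w) ->
  {for p, continuous ('D_u f)} -> {for p, continuous ('D_w f)} ->
  is_derive p (a *: u + b *: w) f (a * 'D_u f p + b * 'D_w f p).
Proof.
move=> du dw cu cw; set v := a *: u + b *: w; set l := a * _ + _.
suff L : (fun h => h^-1 *: ((f \o shift p) (h *: v) - f p)) @ 0^' --> l.
  by apply: DeriveDef; [apply/cvg_ex; exists l | exact: cvg_lim].
apply/cvgrPdist_le => e e0.
pose e' := e / (`|a| + `|b| + 1).
have D0 : 0 < `|a| + `|b| + 1 by rewrite ltr_wpDl // addr_ge0.
have e'0 : 0 < e' by rewrite divr_gt0.
move/cvgrPdist_le : cu => /(_ _ e'0) cu.
move/cvgrPdist_le : cw => /(_ _ e'0) cw.
have : \forall z \near p, [/\ derivable f z u, derivable f z w,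
    `|'D_u f p - 'D_u f z| <= e' & `|'D_w f p - 'D_w f z| <= e'].
  by move: cw; apply: filter_app; move: du dw cu; apply: filterS3 => z; split.
move=> /nbhs_ballP[d /= d0 dP].
(* The + 1 only keeps M positive when both steps vanish. *)
pose M := `|a| * `|u| + `|b| * `|w| + 1.
have M0 : 0 < M by rewrite ltr_wpDl // addr_ge0 ?mulr_ge0.
near=> h.
have h0 : h != 0 by near: h; exact: nbhs_dnbhs_neq.
have hd : `|h| * M < d.
  rewrite -ltr_pdivlMr //; near: h; apply: dnbhs0_lt; exact: divr_gt0.
have nearP (s t : R) : `|s| <= `|h * a| -> `|t| <= `|h * b| ->
    ball p d (t *: w + (s *: u + p)).
  move=> sa tb; rewrite -ball_normE /=.
  rewrite addrA opprD addrCA subrr addr0 normrN.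
  apply: le_lt_trans hd; rewrite (le_trans (ler_normD _ _)) // !normrZ.
  rewrite /M mulrDr mulr1 ler_wpDr // addrC mulrDr !mulrA.
  by apply: lerD; rewrite ler_wpM2r // -normrM.
have nearPu (s : R) : `|s| <= `|h * a| -> ball p d (s *: u + p).
  move=> sa; have := nearP s 0 sa; rewrite normr0 scale0r add0r.
  by apply; exact: normr_ge0.
have shrink (s x : R) : s \in `[0, 1] -> `|s * x| <= `|x|.
  by rewrite in_itv /= => /andP[s0 s1]; rewrite normrM ger0_norm // ler_piMl.
have [s sa Es] : exists2 s : R, `|s| <= `|h * a| &
    f ((h * a) *: u + p) - f p = (h * a) * 'D_u f (s *: u + p).
  have [s /shrink sa|s /subset_itv_oo_cc /shrink sa ->] :=
      @MVT_line _ _ f p u (h * a).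
    by have /dP[] := nearPu _ (sa _).
  by exists (s * (h * a)).
have [t tb Et] : exists2 t : R, `|t| <= `|h * b| &
    f ((h * b) *: w + ((h * a) *: u + p)) - f ((h * a) *: u + p) =
    (h * b) * 'D_w f (t *: w + ((h * a) *: u + p)).
  have [t /shrink tb|t /subset_itv_oo_cc /shrink tb ->] :=
      @MVT_line _ _ f ((h * a) *: u + p) w (h * b).
    by have /dP[] := nearP _ _ (lexx _) (tb _).
  by exists (t * (h * b)).
have Ev : h *: v + p = (h * b) *: w + ((h * a) *: u + p).
  by rewrite /v scalerDr !scalerA addrCA addrA.
have -> : h^-1 *: ((f \o shift p) (h *: v) - f p) =
    a * 'D_u f (s *: u + p) + b * 'D_w f (t *: w + ((h * a) *: u + p)).
  rewrite -[LHS]/(h^-1 * (f (h *: v + p) - f p)) Ev.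
  rewrite -(subrKA (f ((h * a) *: u + p))) Es Et.
  by field.
have /dP[_ _ Ku _] := nearPu s sa.
have /dP[_ _ _ Kw] := nearP (h * a) t (lexx _) tb.
rewrite /l opprD addrACA -!mulrBr.
rewrite (le_trans (ler_normD _ _)) // !normrM.
apply: (@le_trans _ _ (`|a| * e' + `|b| * e')).
  by apply: lerD; apply: ler_wpM2l.
by rewrite -mulrDl /e' mulrCA ger_pMr // ler_pdivrMr // mul1r lerDl.
Unshelve. all: by end_near. Qed.

(** * Smoothness on open sets *)

Lemma partial_near_eq (R : realType) (i : 'I_2) (f g : 'rV[R]_2 -> R)
    (z : 'rV[R]_2) :
  (\near z, f z = g z) -> \near z, partial i f z = partial i g z.
Proof.
move=> /near_join; apply: filterS => w; exact: near_eq_derive.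
Qed.

Lemma iter_partial_near_eq (R : realType) (s : seq 'I_2)
    (f g : 'rV[R]_2 -> R) (z : 'rV[R]_2) :
  (\near z, f z = g z) -> \near z, iter_partial s f z = iter_partial s g z.
Proof. by move=> fg; elim: s => //= i s; exact: partial_near_eq. Qed.

(** On an open set the local smooth representatives agree with f on a full
    neighbourhood, so they share all iterated partial derivatives with f. *)
Lemma smooth_on_open (R : realType) (A : set 'rV[R]_2) (f : 'rV[R]_2 -> R) :
  open A -> smooth_on A f -> smooth_open A f.
Proof.
move=> oA fA s z Az; have [U [g [oU Uz gU fg]]] := fA z Az.
have gf : \near z, g z = f z.
  near=> w; apply/esym/fg; rewrite inE; split; near: w; exact: open_nbhs_nbhs.
have [cg dg] := gU s z Uz.
have E := @iter_partial_near_eq _ s _ _ _ gf; split=> [|i].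
  rewrite /prop_for /continuous_at -(nbhs_singleton E).
  by apply: cvg_trans (near_eq_cvg E) _; exact: cg.
exact: near_eq_derivable (dg i).
Unshelve. all: by end_near. Qed.

(** * The unit disc *)

Lemma sum_ord2 (R : nmodType) (F : 'I_2 -> R) : \sum_i F i = F 0 + F 1.
Proof.
rewrite !big_ord_recl big_ord0 addr0; by congr (_ + F _); apply: val_inj.
Qed.

Lemma dotp_continuous (R : realType) :
  continuous (fun z : 'rV[R]_2 => dotp z z).
Proof.
move=> z; rewrite /dotp (_ : (fun w : 'rV[R]_2 => _) =
  fun w : 'rV[R]_2 => w 0 0 * w 0 0 + w 0 1 * w 0 1); last first.
  by apply/funext => w; rewrite sum_ord2.
have c0 := @coord_continuous R 1 2 0 0 z.
have c1 := @coord_continuous R 1 2 0 1 z.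
exact: cvgD (cvgM c0 c0) (cvgM c1 c1).
Qed.

Lemma unit_disc_open (R : realType) : open (@unit_disc R).
Proof.
by apply: (@open_comp _ _ (fun z => dotp z z) [set x | x < 1]);
  [move=> z _; exact: dotp_continuous|exact: open_lt].
Qed.

(** The max norm is bounded by the Euclidean one; this makes Euclidean
    boundedness usable for compactness. *)
Lemma unit_disc_norm (R : realType) (z : 'rV[R]_2) :
  unit_disc z -> `|z| <= 1.
Proof.
move=> z1; rewrite /Num.norm /= mx_normrE.
apply/bigmax_leP; split=> // -[i j] _.
rewrite /= ord1 -(@expr_le1 _ 2) // real_normK ?num_real //.
apply: ltW; apply: le_lt_trans z1; rewrite /dotp (bigD1 j) //= -expr2 lerDl.
by apply: sumr_ge0 => k _; rewrite -expr2 sqr_ge0.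
Qed.

Lemma compact_closure_disc (R : realType) (A : set 'rV[R]_2) :
  closure A `<=` @unit_disc R -> compact (closure A).
Proof.
move=> AD; apply: bounded_closed_compact; last exact: closed_closure.
exists 1; split => // M M1 z /AD /unit_disc_norm zM.
exact: le_trans zM (ltW M1).
Qed.

(** * Curvature of a conformal metric *)

Section ConformalCurvature.
Variables (R : realType) (f : 'rV[R]_2 -> R).

(** The i-th partial derivative of log f, written without the logarithm. *)
Definition dlog (i : 'I_2) (w : 'rV[R]_2) : R := partial i f w / f w.

Lemma partial_conformal (w : 'rV[R]_2) (i j k : 'I_2) :
  derivable f w (delta_mx 0 i) ->
  partial i (fun w => conformal_metric f w j k) w =
  (2 * f w * partial i f w) *+ (j == k).
Proof.
move=> df; rewrite /partial /conformal_metric.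
under [X in derive X]eq_fun => u do rewrite mxE.
case: (j == k) => /=; last by rewrite (derive_cst (0 : R)).
have -> : (fun u => f u ^+ 2 *+ 1) = f ^+ 2.
  by apply/funext => u; rewrite mulr1n exprfctE.
by rewrite deriveX //= expr1 mulr1n.
Qed.

Lemma christoffel_conformal (w : 'rV[R]_2) (i j k : 'I_2) :
  f w != 0 -> (forall i, derivable f w (delta_mx 0 i)) ->
  christoffel (conformal_metric f) k i j w =
  dlog i w *+ (k == j) + dlog j w *+ (k == i) - dlog k w *+ (i == j).
Proof.
move=> f0 df; rewrite /christoffel (bigD1 k) //= big1 ?addr0; last first.
  move=> l lk; rewrite invmx_scalar mxE eq_sym (negbTE lk) mulr0n mul0r //.
rewrite !partial_conformal // invmx_scalar mxE eqxx mulr1n /dlog.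
rewrite [j == k]eq_sym [i == k]eq_sym.
move: (partial i f w) (partial j f w) (partial k f w) (f w) f0 => a b c x x0.
by case: (k == j); case: (k == i); case: (i == j);
  rewrite ?mulr1n ?mulr0n; field.
Qed.

Lemma derivable_dlog (z v : 'rV[R]_2) (i : 'I_2) :
  f z != 0 -> derivable f z v -> derivable (partial i f) z v ->
  derivable (dlog i) z v.
Proof. by move=> f0 df d2f; exact: derivableM d2f (derivableV f0 df). Qed.

(** The quadratic terms in the Christoffel symbols cancel in dimension two, and
    only the divergence of grad (log f), that is the Laplacian of log f, is
    left. *)
Lemma gaussian_curvature_conformal (z : 'rV[R]_2) :
  (\forall w \near z, f w != 0 /\ forall i, derivable f w (delta_mx 0 i)) ->
  (forall i, derivable (partial i f) z (delta_mx 0 i)) ->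
  gaussian_curvature (conformal_metric f) z =
  - (\sum_(i < 2) partial i (dlog i) z) / f z ^+ 2.
Proof.
move=> nf d2f; have [f0 df] := nbhs_singleton nf.
have e01 : ((0 : 'I_2) == 1) = false by [].
have dG0 : partial 0 (christoffel (conformal_metric f) 0 1 1) z =
    - partial 0 (dlog 0) z.
  rewrite {2}/partial -deriveN; last exact: derivable_dlog.
  apply: near_eq_derive; apply: filterS nf => w [fw dfw].
  rewrite (christoffel_conformal _ _ _ _ fw dfw) eqxx e01.
  by rewrite !mulr0n !add0r mulr1n.
have dG1 : partial 1 (christoffel (conformal_metric f) 0 0 1) z =
    partial 1 (dlog 1) z.
  apply: near_eq_derive; apply: filterS nf => w [fw dfw].
  rewrite (christoffel_conformal _ _ _ _ fw dfw) eqxx e01.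
  by rewrite !mulr0n add0r subr0 mulr1n.
rewrite /gaussian_curvature !sum_ord2 /conformal_metric det_scalar.
rewrite !mxE /= mulr0n mul0r addr0 mulr1n.
rewrite /riemann sum_ord2 -/(conformal_metric f) dG0 dG1.
rewrite !christoffel_conformal //=.
move: (partial 0 _ z) (partial 1 _ z) (dlog 0 z) (dlog 1 z) (f z) f0.
by move=> a b u w x x0; rewrite !mulr1n !mulr0n; field.
Qed.

End ConformalCurvature.

Arguments dlog {R} f i w.

(** * The maximum principle *)

Lemma line_cvg (R : realType) (V : normedModType R) (z v : V) :
  (fun t : R => t *: v + z) @ (0 : R) --> z.
Proof.
have c : {for 0, continuous (fun t : R => t *: v + z)}.
  by move=> t; apply: cvgD; [exact: scalel_continuous|exact: cvg_cst].
by move: c; rewrite /prop_for /continuous_at scale0r add0r.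
Qed.

Lemma partial_at_max (R : realType) (f : 'rV[R]_2 -> R) (z : 'rV[R]_2) i :
  (\forall w \near z, derivable f w (delta_mx 0 i) /\ f w <= f z) ->
  partial i f z = 0.
Proof.
move=> nf; set v : 'rV[R]_2 := delta_mx 0 i.
have /nbhs_ballP[d /= d0 dP] := line_cvg _ _ z v _ nf.
have sub (t : R) : t \in `]-d, d[ -> ball (0 : R) d t.
  by rewrite in_itv /= -ball_normE /= sub0r normrN ltr_norml.
have zE : 0 *: v + z = z by rewrite scale0r add0r.
have D0 : is_derive (0 : R) 1 (fun t : R => f (t *: v + z)) (partial i f z).
  have := @is_derive_line R _ f z v 0; rewrite zE; apply.
  by have [] := nbhs_singleton nf.
have M0 : is_derive (0 : R) 1 (fun t : R => f (t *: v + z)) 0.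
  apply: (@derive1_at_max R _ (-d) d).
  - by rewrite ge0_cp // ltW.
  - by move=> t /sub/dP[/is_derive_line[]].
  - by rewrite in_itv /= oppr_lt0 d0.
  - by move=> t /sub/dP[_]; rewrite zE.
by rewrite -(@derive_val _ _ _ _ _ _ _ D0) (@derive_val _ _ _ _ _ _ _ M0).
Qed.

(** If u = (partial i f) / f had a positive derivative at z along the i-th axis,
    then, since u(z) = 0, u and hence partial i f would be positive just after
    z, and f would exceed its maximum by the mean value theorem. *)
Lemma partial_dlog_at_max (R : realType) (f : 'rV[R]_2 -> R) (z : 'rV[R]_2) i :
  (\forall w \near z,
    [/\ 0 < f w, derivable f w (delta_mx 0 i) & f w <= f z]) ->
  derivable (partial i f) z (delta_mx 0 i) ->
  partial i (dlog f i) z <= 0.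
Proof.
move=> nf d2f; set v : 'rV[R]_2 := delta_mx 0 i.
have [fz0 dfz _] := nbhs_singleton nf.
have p0 : partial i f z = 0.
  by apply: partial_at_max; apply: filterS nf => w [].
have du : derivable (dlog f i) z v.
  by apply: derivable_dlog => //; rewrite gt_eqF.
rewrite leNgt; apply/negP => pos.
have /nbhs_ballP[d /= d0 dP] := line_cvg _ _ z v _ nf.
have : \forall h \near 0^',
    0 < h^-1 *: ((dlog f i \o shift z) (h *: v) - dlog f i z).
  exact: (cvgr_gt _ du _ pos).
move=> /nbhs_ballP[r /= r0 rP].
(* A step strictly inside both neighbourhoods. *)
pose m := Num.min d r / 2.
have mm : 0 < Num.min d r by rewrite lt_min d0.
have m0 : 0 < m by rewrite divr_gt0.
have md : m < Num.min d r by rewrite ltr_pdivrMr // ltr_pMr // ltr1n.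
have mP (t : R) : t \in `[0, 1] ->
    ball (0 : R) d (t * m) /\ ball (0 : R) r (t * m).
  rewrite in_itv /= => /andP[t0 t1].
  have tm0 : 0 <= t * m by apply: mulr_ge0 => //; exact: ltW.
  rewrite -!ball_normE /= sub0r normrN ger0_norm //.
  have : t * m < Num.min d r by apply: le_lt_trans md; rewrite ler_piMl // ltW.
  by rewrite lt_min => /andP.
have m1 : ball (0 : R) d m.
  by have [] := mP 1; rewrite ?mul1r // in_itv /= ler01 lexx.
have [t /mP[/dP[_ + _] _] //|t t01 E] := @MVT_line R _ f z v m.
have [/dP[fpos _ _] tr] := mP t (subset_itv_oo_cc t01).
have tm0 : 0 < t * m.
  by rewrite mulr_gt0 //; move: t01; rewrite in_itv => /andP[].
have := rP _ tr; rewrite gt_eqF // => /(_ isT).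
rewrite /= /dlog p0 mul0r subr0 /GRing.scale /= pmulr_rgt0 ?invr_gt0 //.
rewrite pmulr_lgt0 ?invr_gt0 // => Dpos.
have /dP[_ _] := m1; rewrite leNgt -subr_gt0 E.
by rewrite mulr_gt0.
Qed.

Lemma curvature_ge0_at_max (R : realType) (f : 'rV[R]_2 -> R) (z : 'rV[R]_2) :
  (\forall w \near z,
    [/\ 0 < f w, forall i, derivable f w (delta_mx 0 i) & f w <= f z]) ->
  (forall i, derivable (partial i f) z (delta_mx 0 i)) ->
  0 <= gaussian_curvature (conformal_metric f) z.
Proof.
move=> nf d2f; rewrite gaussian_curvature_conformal //; last first.
  by apply: filterS nf => w [fw dfw _]; rewrite gt_eqF.
rewrite mulr_ge0 ?invr_ge0 ?sqr_ge0 // oppr_ge0; apply: sumr_le0 => i _.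
by apply: partial_dlog_at_max => //; apply: filterS nf => w [].
Qed.

Lemma closure_open_boundary (R : realType) (A : set 'rV[R]_2) :
  open A -> closure A = A `|` boundary A.
Proof.
move=> /interior_id iA; rewrite /boundary iA setDUK //.
exact: subset_closure.
Qed.

(** The maximum principle for the strictly subharmonic function log f. *)
Lemma negative_curvature_max_boundary (R : realType) (V : set 'rV[R]_2)
    (f : 'rV[R]_2 -> R) :
  open V -> V !=set0 -> closure V `<=` @unit_disc R ->
  smooth_open (@unit_disc R) f -> (forall z, unit_disc z -> 0 < f z) ->
  (forall z, V z -> gaussian_curvature (conformal_metric f) z < 0) ->
  exists2 z0, boundary V z0 & forall z, closure V z -> f z <= f z0.
Proof.
move=> oV [v Vv] VD fS fpos Kneg.
have [||z0 + z0max] :=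
    @EVT_max_rV R 2 f (closure V) _ (compact_closure_disc _ _ VD).
- by exists v; exact: subset_closure.
- by apply: continuous_in_subspaceT => z; rewrite inE => /VD /(fS [::])[].
rewrite inE => z0V.
move: (z0V); rewrite {1}closure_open_boundary // => -[Vz0|bz0]; last first.
  by exists z0 => // z /mem_set; exact: z0max.
have := Kneg z0 Vz0; rewrite ltNge curvature_ge0_at_max // => [|i].
  have : \forall z \near z0, V z by apply: open_nbhs_nbhs.
  apply: filterS => z /subset_closure Vz; have Dz := VD z Vz.
  by split; [exact: fpos|have [] := fS [::] z Dz|exact: z0max (mem_set Vz)].
by have [] := fS [:: i] z0 (VD z0 (subset_closure Vz0)).
Qed.

(** * Non-extendability *)

Theorem theorem2p9p1 (R : realType) (c : R -> 'rV[R]_2) (V : set 'rV[R]_2)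
  (lambda_out : 'rV[R]_2 -> R) (tmax : R) (n : 'rV[R]_2)
  (c_curve : simple_closed_smooth_curve c)
  (c_disc : range c `<=` punctured_disc)
  (c_V : bounds_domain c V)
  (V_disc : V `<=` unit_disc)
  (V_0 : V 0)
  (lambda_out_smooth : smooth_on (unit_disc `\` V) lambda_out)
  (lambda_out_pos : forall z, (unit_disc `\` V) z -> 0 < lambda_out z)
  (lambda_out_max : forall z, range c z -> lambda_out z <= lambda_out (c tmax))
  (n_out : outward_normal V c tmax n)
  (dn_neg : normal_derivative lambda_out n (c tmax) < 0) :
  ~ exists lambda : 'rV[R]_2 -> R,
      [/\ smooth_on unit_disc lambda,
          forall z, unit_disc z -> 0 < lambda z,
          forall z, (unit_disc `\` V) z -> lambda z = lambda_out z &
          forall z, V z -> gaussian_curvature (conformal_metric lambda) z < 0].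
Proof.
move=> [f [/smooth_on_open - /(_ (@unit_disc_open R)) fS fpos f_out Kneg]].
have [oV _ bV] := c_V; set p := c tmax in lambda_out_max n_out dn_neg.
have cp : range c p by exists tmax.
have curve_out z : range c z -> (unit_disc `\` V) z.
  move=> cz; split; first by have /andP[] := c_disc z cz.
  by move: cz; rewrite -bV /boundary (interior_id V).1 // => -[].
have VD : closure V `<=` unit_disc.
  rewrite closure_open_boundary // bV => z [/V_disc //|/curve_out[]//].
have [z0 bz0 z0max] : exists2 z0, boundary V z0 &
    forall z, closure V z -> f z <= f z0.
  by apply: negative_curvature_max_boundary => //; exists 0.
have pmax z : closure V z -> f z <= f p.
  move=> /z0max fz; apply: le_trans fz _; rewrite bV in bz0.
  by rewrite !f_out; [exact: lambda_out_max| exact: curve_out..].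
have [Dp _] := curve_out p cp.
have df i : \forall z \near p, derivable f z (delta_mx 0 i).
  near=> z; have /(fS [::])[_] : unit_disc z.
    by near: z; exact: open_nbhs_nbhs (conj (@unit_disc_open R) Dp).
  exact.
have dc i : {for p, continuous (partial i f)} by have [] := fS [:: i] p Dp.
have dn : derivable f p n.
  have [+ _] := is_derive_combination _ _ f p (delta_mx 0 0) (delta_mx 0 1)
    (n 0 0) (n 0 1) (df 0) (df 1) (dc 0) (dc 1).
  by congr derivable; rewrite [in RHS](row_sum_delta n) sum_ord2.
have [_ _ sides] := n_out.
(* Near p on the outer side f is lambda_out, so the right-hand limit of its
   difference quotients is the normal derivative. *)
have right : normal_derivative lambda_out n p = 'D_n f p.
  apply: cvg_lim => //.
  have dn' : (fun h : R => h^-1 *: ((f \o shift p) (h *: n) - f p)) @ 0^'+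
      --> 'D_n f p.
    apply: cvg_trans dn => A /nbhs_ballP [_ /posnumP[e] xe_A].
    by exists e%:num => //= y xe_y /gt_eqF/negbT/xe_A; exact.
  apply: cvg_trans dn'; apply: near_eq_cvg.
  have Ds : \forall s \near 0^'+, unit_disc (s *: n + p).
    have lc := cvg_at_right_filter (line_cvg _ _ p n).
    exact: lc _ (open_nbhs_nbhs (conj (@unit_disc_open R) Dp)).
  move: Ds sides; apply: filterS2 => s Ds [nV _].
  rewrite /= f_out; last by split=> //; rewrite addrC.
  by rewrite f_out ?[p + _]addrC //; exact: curve_out.
rewrite right in dn_neg.
(* The quotients are negative for small h of either sign; h = - s reaches
   into V. *)
have : \forall h \near 0^', h^-1 *: ((f \o shift p) (h *: n) - f p) < 0.
  exact: (cvgr_lt _ dn _ dn_neg).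
move=> /nbhs_ballP[r /= r0 rP].
have [s [s0 sr Vs]] : exists s : R, [/\ 0 < s, s < r & V (p - s *: n)].
  near (0 : R)^'+ => s; exists s; split.
  - by near: s; exact: nbhs_right_gt.
  - by near: s; exact: nbhs_right_lt.
  - by have [] := near sides s.
have := rP (- s); rewrite /= -ball_normE /= sub0r opprK gtr0_norm // => /(_ sr).
rewrite oppr_eq0 gt_eqF // => /(_ isT).
rewrite invrN !scaleNr [- _ + p]addrC oppr_lt0.
rewrite -[X in 0 < X]/(s^-1 * (f (p - s *: n) - f p)).
rewrite pmulr_rgt0 ?invr_gt0 // subr_gt0 ltNge pmax //; exact: subset_closure.
Unshelve. all: by end_near. Qed.
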